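(* There is an absolute constant $c>0$ such that for every finite set $A\subset\mathbb{R}$ with $|A|\ge 2$, writing $D:=A-A$, one has $$|DD|\ \ge\ c\,|D|^{1+\frac{1}{12}}(\log|D|)^{-\frac14}\quad\text{and}\quad |D/D|\ \ge\ c\,|D|^{1+\frac{1}{12}}(\log|D|)^{-\frac14}.$$
   Context: For finite $X,Y\subset\mathbb{R}$: $X-Y=\{x-y: x\in X,\,y\in Y\}$, $XY=\{xy: x\in X,\,y\in Y\}$, $X/Y=\{x/y: x\in X,\,y\in Y,\,y\ne 0\}$. $|\cdot|$ denotes cardinality. Logarithms are to base $2$. *)

(* Defs.v *)
From HB Require Import structures.
From mathcomp Require Import all_boot all_order all_algebra.
From mathcomp Require Import finmap.
From mathcomp Require Import reals exp.

Set Implicit Arguments.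
Unset Strict Implicit.
Unset Printing Implicit Defensive.

Import Order.TTheory GRing.Theory Num.Theory.
Local Open Scope fset_scope.
Local Open Scope ring_scope.

Definition diffset (R : realType) (X Y : {fset R}) : {fset R} :=
  [fset x - y | x in X, y in Y].

Definition prodset (R : realType) (X Y : {fset R}) : {fset R} :=
  [fset x * y | x in X, y in Y].

(* Division is total in MathComp (x / 0 = 0), so zero denominators are
   excluded explicitly. *)
Definition ratioset (R : realType) (X Y : {fset R}) : {fset R} :=
  [fset x / y | x in X, y in Y & y != 0].

Definition log2 (R : realType) (x : R) : R := ln x / ln 2.

(* Main.v *)
Require Import Defs.
From mathcomp Require Import all_boot all_order all_algebra.
From mathcomp Require Import finmap.
From mathcomp Require Import reals exp.
From mathcomp Require Import zify ring lra.

Set Implicit Arguments.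
Unset Strict Implicit.
Unset Printing Implicit Defensive.

Import Order.TTheory GRing.Theory Num.Theory.
Local Open Scope fset_scope.
Local Open Scope ring_scope.

(* Let X be the set of ratios (b - a) / (c - a) with a, b, c in A and a <> c.

   Equal ratios for (a, b, c) and (a', b', c') mean that (a, a'), (b, b'),
   (c, c') are collinear points of A x A, so by Cauchy-Schwarz and the count of
   collinear triples in a grid, |A|^2 << |X| log |A|.

   Since 1 - X = X, every line v = z - (z / y) u with nonzero y, z in D meets
   P x P, P = X D, in at least |X| points, so |D|^2 |X|^3 << |P|^4. Up to zero,
   P lies in D D / D (D without 0), which Plunnecke's inequality bounds by
   |DD|^3 / |D|^2 and by |D/D|^3 / |D|^2. Comparing the two bounds gives the
   exponent 13/12.

   Only incidences with Cartesian products occur, so Szemeredi-Trotter can be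
   replaced by cutting the grid into q x q blocks: a monotone line with at least
   4q points on A x B meets at most 2q blocks and hence contains many pairs of
   points lying in a common block, while two points determine the line. *)

(** * Counting by injections and fibres *)

Lemma in_fset_sep (T : choiceType) (A : {fset T}) (P : pred T) (x : T) :
  (x \in [fset y in A | P y]) = (x \in A) && P x.
Proof. by rewrite !inE. Qed.

Lemma leq_card_fset_inj (T U : choiceType) (f : T -> U) (A : {fset T})
    (B : {fset U}) :
  {in A, forall x, f x \in B} -> {in A &, injective f} ->
  (#|` A| <= #|` B|)%N.
Proof.
move=> fAB f_inj; rewrite -(card_in_imfset imfset_key f_inj).
by apply/fsubset_leq_card/fsubsetP => _ /imfsetP[x xA ->]; exact: fAB.
Qed.

Lemma leq_card_fimfset (T U : choiceType) (f : T -> U) (A : {fset T}) :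
  (#|` f @` A| <= #|` A|)%N.
Proof. exact: leq_imfset_card. Qed.

Lemma card_fset_dep (I J : choiceType) (A : {fset I}) (B : I -> {fset J}) :
  #|` [fset ((i, j) : I * J) | i in A, j in B i]| = (\sum_(i <- A) #|` B i|)%N.
Proof.
rewrite card_fset_sum1 big_imfset2 /=; last by move=> [? ?] [? ?] _ _ [-> ->].
by apply: eq_bigr => i _; rewrite card_fset_sum1.
Qed.

Lemma leq_sum_card_inj (I J K : choiceType) (A : {fset I})
    (B : I -> {fset J}) (V : {fset K}) (h : I -> J -> K) :
  (forall i j, i \in A -> j \in B i -> h i j \in V) ->
  (forall i j i' j', i \in A -> j \in B i -> i' \in A -> j' \in B i' ->
     h i j = h i' j' -> i = i' /\ j = j') ->
  (\sum_(i <- A) #|` B i| <= #|` V|)%N.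
Proof.
move=> hV h_inj; rewrite -card_fset_dep.
apply: (@leq_card_fset_inj _ _ (fun p => h p.1 p.2)).
  by move=> _ /imfset2P[i iA [j jB ->]]; exact: hV.
move=> _ _ /imfset2P[i iA [j jB ->]] /imfset2P[i' iA' [j' jB' ->]] /= hE.
by have [-> ->] := h_inj _ _ _ _ iA jB iA' jB' hE.
Qed.

Lemma card_fsetM (I J : choiceType) (A : {fset I}) (B : {fset J}) :
  #|` A `*` B| = (#|` A| * #|` B|)%N.
Proof.
rewrite (card_fset_dep A (fun=> B)) (card_fset_sum1 A) big_distrl /=.
by apply: eq_bigr => i _; rewrite mul1n.
Qed.

Lemma card_fset_fibers (T U : choiceType) (f : T -> U) (V : {fset T}) :
  #|` V| = (\sum_(u <- f @` V) #|` [fset x in V | f x == u]|)%N.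
Proof.
rewrite card_fset_sum1 (partition_big_imfset _ f).
by apply: eq_bigr => u _; rewrite card_fset_sum1 big_fset.
Qed.

Lemma leq_card_fibers (T U : choiceType) (f : T -> U) (V : {fset T})
    (A : {fset U}) (t : nat) :
  {in V, forall x, f x \in A} ->
  {in A, forall u, (#|` [fset x in V | f x == u]| <= t)%N} ->
  (#|` V| <= #|` A| * t)%N.
Proof.
move=> fVA le_t; rewrite (card_fset_fibers f).
have sub : f @` V `<=` A by apply/fsubsetP => _ /imfsetP[x xV ->]; exact: fVA.
apply: leq_trans (leq_mul (fsubset_leq_card sub) (leqnn t)).
rewrite card_fset_sum1 big_distrl /= big_seq [leqRHS]big_seq.
by apply: leq_sum => u /(fsubsetP sub) /le_t; rewrite mul1n.
Qed.

(** * Cauchy-Schwarz for fibre sizes *)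

Lemma leq_sum_sqr (I : Type) (r : seq I) (F : I -> nat) :
  ((\sum_(i <- r) F i) ^ 2 <= size r * \sum_(i <- r) F i ^ 2)%N.
Proof.
elim: r => [|i r IHr]; first by rewrite !big_nil.
rewrite !big_cons /=.
have : (2 * (F i * \sum_(j <- r) F j) <= size r * F i ^ 2 + \sum_(j <- r) F j ^ 2)%N.
  elim: r {IHr} => [|j r IHr]; first by rewrite !big_nil muln0.
  by rewrite !big_cons !mulnDr /= mulSn [leqRHS]addnACA leq_add // nat_Cauchy.
by rewrite sqrnD mulSn mulnDr; lia.
Qed.

(** Ordered pairs with the diagonal included: the cardinal is the sum of the squared fibre sizes,
    the energy of [f]. *)
Definition collisions (T U : choiceType) (f : T -> U) (A : {fset T}) :=
  [fset p in A `*` A | f p.1 == f p.2].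

Lemma card_collisions (T U : choiceType) (f : T -> U) (A : {fset T}) :
  (#|` A| ^ 2 <= #|` f @` A| * #|` collisions f A|)%N.
Proof.
rewrite {1}(card_fset_fibers f); apply: leq_trans (leq_sum_sqr _ _) _.
rewrite leq_mul2l; apply/orP; right.
have -> : (\sum_(u <- f @` A) #|` [fset x in A | f x == u]| ^ 2 =
   \sum_(u <- f @` A)
     #|` [fset x in A | f x == u] `*` [fset x in A | f x == u]|)%N.
  by apply: eq_bigr => u _; rewrite card_fsetM.
apply: (@leq_sum_card_inj _ _ _ _ _ _ (fun _ p => p)).
  move=> u [x y] uA; rewrite in_fsetM !in_fset_sep /= in_fsetM /=.
  by move=> /andP[/andP[-> /eqP->] /andP[-> /eqP->]]; exact: eqxx.
move=> u p u' p' _ + _ + pp'; rewrite -pp' !in_fsetM !in_fset_sep.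
by move=> /andP[/andP[_ /eqP<-] _] /andP[/andP[_ /eqP<-] _].
Qed.

Lemma leq_card_fset_nat (T : choiceType) (f : T -> nat) (A : {fset T}) (n : nat) :
  {in A, forall x, f x < n}%N -> (#|` f @` A| <= n)%N.
Proof.
move=> f_lt; rewrite -[leqRHS](size_iota 0); apply: uniq_leq_size => // i.
by case/imfsetP => x /= xA ->; rewrite mem_iota f_lt.
Qed.

Lemma leq_card_fset_nat_inj (T : choiceType) (f : T -> nat) (A : {fset T}) (n : nat) :
  {in A, forall x, f x < n}%N -> {in A &, injective f} -> (#|` A| <= n)%N.
Proof.
by move=> /leq_card_fset_nat + f_inj; rewrite card_in_imfset.
Qed.

(** * Ranks and balanced blocks *)

Definition fset_rank (R : realDomainType) (A : {fset R}) (x : R) : nat :=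
  #|` [fset a in A | a < x]|.

Lemma fset_rank_homo (R : realDomainType) (A : {fset R}) :
  {homo fset_rank A : x y / x <= y >-> (x <= y)%N}.
Proof.
move=> x y xy; apply/fsubset_leq_card/fsubsetP => a; rewrite !in_fset_sep.
by case/andP=> -> /lt_le_trans; exact.
Qed.

Lemma fset_rank_lt (R : realDomainType) (A : {fset R}) (x : R) :
  x \in A -> forall y, x < y -> (fset_rank A x < fset_rank A y)%N.
Proof.
move=> xA y xy; rewrite /fset_rank [leqRHS](cardfsD1 x) in_fset_sep xA xy ltnS.
apply/fsubset_leq_card/fsubsetP => a; rewrite in_fsetD1 !in_fset_sep.
by case/andP=> -> ax; rewrite lt_eqF // (lt_trans ax).
Qed.

Lemma fset_rank_inj (R : realDomainType) (A : {fset R}) :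
  {in A &, injective (fset_rank A)}.
Proof.
move=> x y xA yA xy; case: (ltgtP x y) => // [/(fset_rank_lt xA)|/(fset_rank_lt yA)];
  by rewrite xy ltnn.
Qed.

Lemma fset_rank_ltcard (R : realDomainType) (A : {fset R}) (x : R) :
  x \in A -> (fset_rank A x < #|` A|)%N.
Proof.
move=> xA; rewrite [leqRHS](cardfsD1 x) xA ltnS.
apply/fsubset_leq_card/fsubsetP => a; rewrite in_fsetD1 in_fset_sep.
by case/andP=> -> /lt_eqF ->.
Qed.

(** Each block is a run of [t] consecutive ranks, so an element of [A] collides with at most [t]
    elements of [A]. *)
Lemma balanced_blocks (R : realDomainType) (A : {fset R}) (q : nat) :
  (0 < q <= #|` A|)%N ->
  exists b : R -> nat,
    [/\ {homo b : x y / x <= y >-> (x <= y)%N},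
        {in A, forall x, b x < q}%N &
        (#|` collisions b A| * q <= 2 * #|` A| ^ 2)%N].
Proof.
case/andP=> q_gt0 le_qA; pose t := (#|` A| %/ q).+1.
have ltAqt : (#|` A| < q * t)%N by rewrite mulnC -ltn_divLR.
have leqtA : (t * q <= 2 * #|` A|)%N.
  by have := leq_trunc_div #|` A| q; rewrite /t mulSn; lia.
exists (fun x => fset_rank A x %/ t)%N; split.
- by move=> x y xy; apply: leq_div2r; exact: fset_rank_homo.
- move=> x xA; rewrite ltn_divLR //.
  exact: ltn_trans (fset_rank_ltcard xA) ltAqt.
have fib : (#|` collisions (fun x => fset_rank A x %/ t)%N A| <= #|` A| * t)%N.
  apply: (@leq_card_fibers _ _ fst).
    by move=> p; rewrite in_fset_sep in_fsetM => /andP[/andP[]].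
  move=> x xA.
  apply: (@leq_card_fset_nat_inj _ (fun p : R * R => fset_rank A p.2 %% t)%N).
    by move=> p _; rewrite ltn_mod.
  move=> [x1 y1] [x2 y2]; rewrite !in_fset_sep !in_fsetM /=.
  move=> /andP[/andP[/andP[_ y1A] /eqP e1] /eqP x1x].
  move=> /andP[/andP[/andP[_ y2A] /eqP e2] /eqP x2x] em.
  rewrite x1x x2x in e1 e2 *; congr (_, _); apply: (fset_rank_inj y1A y2A).
  by rewrite (divn_eq (fset_rank A y1) t) (divn_eq (fset_rank A y2) t) -e1 -e2 em.
apply: leq_trans (leq_mul fib (leqnn q)) _.
by rewrite -mulnA (leq_trans (leq_mul (leqnn _) leqtA)) // mulnCA mulnn.
Qed.

(** * Lines rich in points of a Cartesian product *)

Definition line_pts (R : realFieldType) (A B : {fset R}) (l : R * R) :=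
  [fset x in A | l.1 * x + l.2 \in B].

Lemma line_pts_leq (R : realFieldType) (A B : {fset R}) (l : R * R) :
  l.1 != 0 -> (#|` line_pts A B l| <= #|` A|)%N /\ (#|` line_pts A B l| <= #|` B|)%N.
Proof.
move=> l0; split.
  by apply/fsubset_leq_card/fsubsetP => x; rewrite in_fset_sep => /andP[].
apply: (@leq_card_fset_inj _ _ (fun x => l.1 * x + l.2)).
  by move=> x; rewrite in_fset_sep => /andP[].
by move=> x y _ _ /addIr /(mulfI l0).
Qed.

(* A line of nonzero slope is monotone, so it meets at most [2 q] of the
   [q * q] cells of the grid. *)
Lemma line_cell_collisions (R : realFieldType) (A B : {fset R}) (q : nat)
    (a b : R -> nat) (l : R * R) :
  {homo a : x y / x <= y >-> (x <= y)%N} ->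
  {homo b : x y / x <= y >-> (x <= y)%N} ->
  {in A, forall x, a x < q}%N -> {in B, forall x, b x < q}%N ->
  l.1 != 0 ->
  (#|` line_pts A B l| ^ 2 <=
   2 * q * #|` collisions (fun x => (a x, b (l.1 * x + l.2)%R))
               (line_pts A B l)|)%N.
Proof.
move=> a_homo b_homo aq bq l0; set S := line_pts A B l.
pose y x := l.1 * x + l.2.
(* On a decreasing line the second index is reflected, so both summands are monotone along the line.
   Hence [d] repeats only if both block indices do, and its values are at most [2 * q - 2]. *)
pose d x := (a x + if (0 < l.1)%R then b (y x) else q.-1 - b (y x))%N.
have Sin x : x \in S -> (a x < q)%N /\ (b (y x) < q)%N.
  by rewrite in_fset_sep => /andP[/aq ? /bq ?].
have dP : {in S &, forall x x', d x = d x' -> x <= x' ->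
    a x = a x' /\ b (y x) = b (y x')}.
  move=> x x' /Sin[ax bx] /Sin[ax' bx'] + xx'; have := a_homo _ _ xx'.
  rewrite /d; case: ltP => l1.
    have : (b (y x) <= b (y x'))%N by apply: b_homo; rewrite lerD2r ler_pM2l.
    by lia.
  have : (b (y x') <= b (y x))%N.
    by apply: b_homo; rewrite lerD2r ler_wnM2l.
  by lia.
apply: leq_trans (card_collisions d S) _; apply: leq_mul.
  by apply: leq_card_fset_nat => x /Sin[ax bx]; rewrite /d; case: ifP => _; lia.
apply/fsubset_leq_card/fsubsetP => -[x x']; rewrite !in_fset_sep in_fsetM /=.
move=> /andP[/andP[xS x'S] /eqP dxx']; rewrite xS x'S /=.
have [/(dP _ _ xS x'S dxx')|/ltW /(dP _ _ x'S xS (esym dxx'))] := leP x x';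
  by case=> /= -> ->.
Qed.

(** Double counting of pairs of distinct points in a common cell: every line carries at least
    [4 * q] of them, no pair lies on two lines, and by [balanced_blocks] there are at most
    4|A|^2|B|^2 / q^2 in all. *)
Lemma card_rich_lines (R : realFieldType) (A B : {fset R})
    (L : {fset R * R}) (q : nat) :
  (0 < q)%N ->
  {in L, forall l, l.1 != 0 /\ (4 * q <= #|` line_pts A B l|)%N} ->
  (#|` L| * q ^ 3 <= #|` A| ^ 2 * #|` B| ^ 2)%N.
Proof.
move=> q_gt0 Lrich.
(* A single rich line already forces [q] to be at most |A| and |B|, as [balanced_blocks]
   requires. *)
have [->|[l0 l0L]] := fset_0Vmem L; first by rewrite cardfs0.
have [l0_neq0 l0_rich] := Lrich _ l0L; have [lA lB] := line_pts_leq A B l0_neq0.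
have leq4 : (q <= #|` line_pts A B l0|)%N by apply: leq_trans l0_rich; rewrite leq_pmull.
have [a [a_homo aq a_coll]] : exists a : R -> nat,
    [/\ {homo a : x y / x <= y >-> (x <= y)%N}, {in A, forall x, a x < q}%N &
        (#|` collisions a A| * q <= 2 * #|` A| ^ 2)%N].
  by apply: balanced_blocks; rewrite q_gt0 (leq_trans leq4).
have [b [b_homo bq b_coll]] : exists b : R -> nat,
    [/\ {homo b : x y / x <= y >-> (x <= y)%N}, {in B, forall x, b x < q}%N &
        (#|` collisions b B| * q <= 2 * #|` B| ^ 2)%N].
  by apply: balanced_blocks; rewrite q_gt0 (leq_trans leq4).
pose y (l : R * R) x := l.1 * x + l.2.
pose C (l : R * R) := [fset p in collisions (fun x => (a x, b (y l x)))
                              (line_pts A B l) | p.1 != p.2].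
have C_ge l : l \in L -> (4 * q <= #|` C l|)%N.
  move=> /Lrich[l1 l_rich].
  have := line_cell_collisions a_homo b_homo aq bq l1.
  set K := collisions _ _ => leK.
  have : (#|` K| <= #|` C l| + #|` line_pts A B l|)%N.
    rewrite -(cardfsID [fset p | p in K & p.1 != p.2] K) leq_add //.
      by apply/fsubset_leq_card/fsubsetP => p; rewrite in_fsetI => /andP[].
    apply: (@leq_card_fset_inj _ _ fst).
      move=> p; rewrite in_fsetD => /andP[_].
      by rewrite in_fset_sep in_fsetM => /andP[/andP[]].
    have diag p : p \in K `\` [fset p | p in K & p.1 != p.2] -> p.2 = p.1.
      by rewrite in_fsetD in_fset_sep => /andP[+ pK]; rewrite pK negbK => /eqP.
    by move=> [x1 x2] [x3 x4] /diag /= -> /diag /= -> /= ->.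
  (* Since [n >= 4 * q], the n^2 / (2q) collisions number at least 2n; discarding the n diagonal
     ones leaves n. *)
  move: leK l_rich; set n := #|` line_pts A B l|; nia.
have leLC : (#|` L| * (4 * q) <= \sum_(l <- L) #|` C l|)%N.
  rewrite card_fset_sum1 big_distrl /= big_seq [leqRHS]big_seq.
  by apply: leq_sum => l lL; rewrite mul1n C_ge.
have : (\sum_(l <- L) #|` C l| <= #|` collisions a A `*` collisions b B|)%N.
  apply: (@leq_sum_card_inj _ _ _ _ _ _
    (fun l p => (p, (y l p.1, y l p.2)))).
    move=> l [x1 x2] _; rewrite in_fset_sep in_fsetM !in_fset_sep !in_fsetM /=.
    rewrite !in_fset_sep xpair_eqE.
    by move=> /andP[/andP[/andP[/andP[-> ->] /andP[-> ->]] /andP[-> ->]] _].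
  move=> l [x1 x2] l' p' _ + _ _ [<- /=]; rewrite in_fset_sep /= => /andP[_ neq].
  rewrite /y => e1 e2; split=> //.
  have e : (l.1 - l'.1) * (x1 - x2) = 0 by move: e1 e2; lra.
  move/eqP: e; rewrite mulf_eq0 !subr_eq0 (negbTE neq) orbF => /eqP e.
  move: e1; rewrite e => /addrI e'.
  by rewrite [l]surjective_pairing [l']surjective_pairing e e'.
rewrite card_fsetM => le2.
have := leq_mul a_coll b_coll; nia.
Qed.

(** For [k >= 4] the previous bound applies with [q = k %/ 4], where [k <= 7 * q] and 343 = 7^3. For
    smaller [k] the a priori bound on |L| suffices. *)
Lemma card_rich_lines_le (R : realFieldType) (A B : {fset R})
    (L : {fset R * R}) (k : nat) :
  (#|` L| <= #|` A| ^ 2 * #|` B| ^ 2)%N ->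
  {in L, forall l, l.1 != 0 /\ (k <= #|` line_pts A B l|)%N} ->
  (#|` L| * k ^ 3 <= 343 * (#|` A| ^ 2 * #|` B| ^ 2))%N.
Proof.
move=> leL Lrich; have [k_small|k_big] := ltnP k 4.
  have : (k ^ 3 <= 343)%N by apply: (@leq_trans (4 ^ 3)) => //; rewrite leq_exp2r // ltnW.
  by rewrite (mulnC 343%N); exact: leq_mul.
pose q := (k %/ 4)%N.
have le_kq : (k <= 7 * q)%N by rewrite /q; lia.
have q_gt0 : (0 < q)%N by rewrite /q divn_gt0.
have : (k ^ 3 <= 343 * q ^ 3)%N.
  by apply: (@leq_trans ((7 * q) ^ 3)); rewrite ?leq_exp2r // expnMn.
move=> /(leq_mul (leqnn #|` L|)) /leq_trans; apply.
rewrite mulnCA leq_mul2l; apply/orP; right; apply: card_rich_lines => // l lL.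
by have [? le_k] := Lrich _ lL; split=> //; apply: leq_trans le_k; rewrite /q; lia.
Qed.

(** * Third moments and harmonic sums *)

(** Telescoping: j^3 - (j - 1)^3 <= 3 j^2. *)
Lemma leq_cube_sum (m n : nat) : (m <= n)%N ->
  (m ^ 3 <= \sum_(1 <= j < n.+1 | j <= m) 3 * j ^ 2)%N.
Proof.
move=> le_mn; rewrite (big_cat_nat _ (n := m.+1)) //= -[leqLHS]addn0 leq_add //.
have -> : (\sum_(1 <= j < m.+1 | j <= m) 3 * j ^ 2 = \sum_(1 <= j < m.+1) 3 * j ^ 2)%N.
  by apply: congr_big_nat => // i /andP[_].
elim: m {le_mn} => // m IHm; rewrite big_nat_recr //=.
by apply: leq_trans (leq_add IHm (leqnn _)); lia.
Qed.

(** Summation by layers: the third moment is controlled by the number of [j]-rich elements for each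
    threshold [j]. *)
Lemma sum_cubes_rich (I : choiceType) (L : {fset I}) (F : I -> nat) (n : nat) :
  {in L, forall l, F l <= n}%N ->
  (\sum_(l <- L) F l ^ 3 <=
   \sum_(1 <= j < n.+1) 3 * j ^ 2 * #|` [fset l in L | j <= F l]|)%N.
Proof.
move=> Fn.
apply: (@leq_trans (\sum_(l <- L) \sum_(1 <= j < n.+1 | j <= F l) 3 * j ^ 2)).
  by rewrite big_seq [leqRHS]big_seq; apply: leq_sum => l /Fn /leq_cube_sum.
rewrite (exchange_big_dep predT) //=; apply: leq_sum => j _.
by rewrite card_fset_sum1 big_fset big_distrr /=; apply: leq_sum => l _; rewrite muln1.
Qed.

(** By ln (1 - x) <= -x at x = 1 / (n + 1), the logarithm grows by at least 1 / (n + 1) from n to n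
    + 1. *)
Lemma harmonic_le_ln (R : realType) (n : nat) : (0 < n)%N ->
  \sum_(1 <= j < n.+1) j%:R^-1 <= 1 + ln (n%:R : R).
Proof.
elim: n => // -[_ _|n IHn _]; first by rewrite big_nat1 invr1 ln1 addr0.
rewrite big_nat_recr //=; apply: (le_trans (lerD (IHn isT) (lexx _))).
rewrite -addrA lerD2l.
have n1 : (0 : R) < n.+1%:R by rewrite ltr0n.
have n2 : (0 : R) < n.+2%:R by rewrite ltr0n.
have e : n.+1%:R / n.+2%:R = 1 - n.+2%:R^-1 :> R.
  have -> : n.+1%:R = n.+2%:R - 1 :> R by rewrite -(addn1 n.+1) natrD addrK.
  by rewrite mulrBl divff ?mul1r ?lt0r_neq0.
have : ln (1 - n.+2%:R^-1) <= - n.+2%:R^-1 :> R.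
  apply: le_ln1Dx; rewrite ltrN2 invf_lt1 // ltr1n //.
rewrite -e ln_div ?posrE //. by rewrite lerBlDr -lerBrDr [- _ + _]addrC.
Qed.

(** * The set of ratios and its size *)

(** For [t = (a, b, c)], the affine coordinate of [b] in the frame where [a] is 0 and [c] is 1. *)
Definition ratio3 (R : realType) (t : R * R * R) : R :=
  (t.1.2 - t.1.1) / (t.2 - t.1.1).

Definition triples (R : realType) (A : {fset R}) : {fset R * R * R} :=
  [fset t in A `*` A `*` A | t.2 != t.1.1].

Lemma triplesP (R : realType) (A : {fset R}) (a b c : R) :
  reflect [/\ a \in A, b \in A, c \in A & c - a != 0] ((a, b, c) \in triples A).
Proof.
rewrite in_fset_sep !in_fsetM /= subr_eq0.
apply: (iffP andP) => [[/andP[/andP[-> ->] ->] ->]|[-> -> -> ->]] //.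
Qed.

(** The excluded triples have equal outer entries; there are |A|^2 of them, at most half of
    |A|^3. *)
Lemma card_triples (R : realType) (A : {fset R}) : (2 <= #|` A|)%N ->
  (#|` A| ^ 3 <= 2 * #|` triples A|)%N.
Proof.
move=> A2; have : (#|` A `*` A `*` A| <= #|` triples A| + #|` A `*` A|)%N.
  rewrite -(cardfsID (triples A) (A `*` A `*` A)) leq_add //.
    by apply/fsubset_leq_card/fsubsetP => t; rewrite in_fsetI => /andP[].
  apply: (@leq_card_fset_inj _ _ fst).
    by move=> t; rewrite in_fsetD in_fsetM => /andP[_ /andP[]].
  have diag p : p \in A `*` A `*` A `\` triples A -> p.2 = p.1.1.
    by rewrite in_fsetD in_fset_sep => /andP[+ pA]; rewrite pA negbK => /eqP.
  by move=> [p1 x] [p2 y] /diag /= -> /diag /= -> /= ->.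
by rewrite !card_fsetM; move: #|` A| A2 => n A2; nia.
Qed.

(** Slope and intercept of the line through two points; meaningful only when their abscissae
    differ. *)
Definition joining_line (R : realType) (p : (R * R) * (R * R)) : R * R :=
  let m := (p.2.2 - p.1.2) / (p.2.1 - p.1.1) in (m, p.1.2 - m * p.1.1).

(* Two triples [(a, b, c)] and [(a', b', c')] have the same ratio exactly when
   [(a, a')], [(b, b')] and [(c, c')] are collinear points of the grid
   [A * A]. *)
Lemma ratio3_energy (R : realType) (A : {fset R}) :
  exists L : {fset R * R},
    [/\ (#|` L| <= #|` A| ^ 2 * #|` A| ^ 2)%N,
        {in L, forall l, l.1 != 0} &
        (#|` collisions (@ratio3 R) (triples A)|
          <= \sum_(l <- L) #|` line_pts A A l| ^ 3)%N].
Proof.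
(* Pairs of grid points differing in both coordinates, so that the joining line has a finite nonzero
   slope. *)
pose Q := [fset p in (A `*` A) `*` (A `*` A) |
            (p.2.1 - p.1.1 != 0) && (p.2.2 - p.1.2 != 0)].
exists (@joining_line R @` Q); split.
- apply: leq_trans (leq_imfset_card _ _ _) _; rewrite /= -!mulnn -!card_fsetM.
  by apply/fsubset_leq_card/fsubsetP => p; rewrite in_fset_sep => /andP[].
- move=> _ /imfsetP[p /= + ->]; rewrite in_fset_sep => /and3P[_ p1 p2] /=.
  by rewrite mulf_neq0 ?invr_eq0.
have -> : (\sum_(l <- joining_line (R := R) @` Q) #|` line_pts A A l| ^ 3 =
    \sum_(l <- joining_line (R := R) @` Q)
      #|` line_pts A A l `*` line_pts A A l `*` line_pts A A l|)%N.
  by apply: eq_bigr => l _; rewrite !card_fsetM expnSr -mulnn.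
rewrite -card_fset_dep.
(* The line through (a, a') and (c, c'); equality of the ratios puts (b, b') on it. *)
pose ln (p : (R * R * R) * (R * R * R)) :=
  joining_line ((p.1.1.1, p.2.1.1), (p.1.2, p.2.2)).
have collP p : p \in collisions (@ratio3 R) (triples A) ->
  [/\ p.1 \in triples A, p.2 \in triples A & ratio3 p.1 = ratio3 p.2].
  by rewrite in_fset_sep in_fsetM => /andP[/andP[-> ->] /eqP].
have lnP p : p \in collisions (@ratio3 R) (triples A) ->
  [/\ (ln p).1 * p.1.1.1 + (ln p).2 = p.2.1.1,
      (ln p).1 * p.1.1.2 + (ln p).2 = p.2.1.2 &
      (ln p).1 * p.1.2 + (ln p).2 = p.2.2].
  move: p => [[[a b] c] [[a' b'] c']] /collP[/triplesP[_ _ _ ca] /triplesP[_ _ _ ca']].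
  rewrite /ratio3 /ln /joining_line /= => e.
  have eb : b = (b' - a') / (c' - a') * (c - a) + a by rewrite -e; field.
  by rewrite eb; split; field; rewrite ?ca ?ca'.
(* The line sends the first triple to the second, so nothing is lost by keeping only the line and
   the first triple. *)
apply: (@leq_card_fset_inj _ _ (fun p => (ln p, p.1))).
  move=> p pC; have [l1 l2 l3] := lnP p pC; have [T1 T2 _] := collP p pC.
  move: p T1 T2 l1 l2 l3 {pC} => [[[a b] c] [[a' b'] c']].
  move=> /triplesP[aA bA cA ca] /triplesP[a'A b'A c'A ca'] /= l1 l2 l3.
  apply/imfset2P; exists (ln ((a, b, c), (a', b', c'))).
    by apply/in_imfset; rewrite /= in_fset_sep !in_fsetM /= aA a'A cA c'A ca ca'.
  exists (a, b, c) => //=.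
  by rewrite !in_fsetM /= !in_fset_sep aA bA cA l1 l2 l3 a'A b'A c'A.
move=> p p' /lnP[l1 l2 l3] /lnP[l1' l2' l3'] e.
have e1 : ln p = ln p' := congr1 fst e; have e2 : p.1 = p'.1 := congr1 snd e.
move: l1 l2 l3 l1' l2' l3' e2; rewrite e1; move: (ln p') => l {e e1}.
case: p p' => [p1 [[a b] c]] [p1' [[a' b'] c']] /= <- <- <- <- <- <- ->.
by [].
Qed.

(** Cauchy-Schwarz gives |T|^2 <= |X| E for the set T of triples, with |T| >= n^3 / 2 and energy E
    <= 1029 n^4 (1 + ln n); hence 4116 = 4 * 1029. *)
Lemma card_ratio3 (R : realType) (A : {fset R}) : (2 <= #|` A|)%N ->
  #|` A|%:R ^+ 2 <=
  4116 * #|` @ratio3 R @` triples A|%:R * (1 + ln (#|` A|%:R : R)).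
Proof.
move=> A2; have [L [L_le L_neq0 leE]] := ratio3_energy A.
set n := #|` A| in A2 L_le *.
(* The weight [3 * j ^ 2] leaves one factor 1 / j of the 1 / j^3 decay of rich lines, whence a
   harmonic sum; 1029 = 3 * 343. *)
have nE (j : nat) : (0 < j)%N ->
  (3 * j ^ 2 * #|` [fset l in L | j <= #|` line_pts A A l|]%N|)%:R
    <= 1029 * n%:R ^+ 4 * j%:R^-1 :> R.
  move=> j_gt0; rewrite ler_pdivlMr ?ltr0n //.
  set Lj := [fset l in L | _].
  have : (#|` Lj| * j ^ 3 <= 343 * (n ^ 2 * n ^ 2))%N.
    apply: card_rich_lines_le.
      apply: leq_trans L_le; apply/fsubset_leq_card/fsubsetP => l.
      by rewrite in_fset_sep => /andP[].
    by move=> l; rewrite in_fset_sep => /andP[/L_neq0].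
  move=> h; rewrite -[4%N]/(2 + 2)%N -natrX -!natrM ler_nat expnD.
  by move: h; rewrite expnSr; lia.
have EH : #|` collisions (@ratio3 R) (triples A)|%:R
    <= 1029 * n%:R ^+ 4 * (1 + ln (n%:R : R)).
  have : (#|` collisions (@ratio3 R) (triples A)| <=
      \sum_(1 <= j < n.+1) 3 * j ^ 2 * #|` [fset l in L | j <= #|` line_pts A A l|]|)%N.
    apply: leq_trans leE _; apply: sum_cubes_rich => l /L_neq0 l0.
    by case: (line_pts_leq A A l0).
  rewrite -(ler_nat R) => /le_trans; apply; rewrite natr_sum.
  apply: (@le_trans _ _ (1029 * n%:R ^+ 4 * \sum_(1 <= j < n.+1) j%:R^-1)).
    rewrite mulr_sumr; apply: ler_sum_nat => j /andP[j_gt0 _]; exact: nE.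
  by rewrite ler_wpM2l ?harmonic_le_ln ?mulr_ge0 ?exprn_ge0 //; lia.
have := card_collisions (@ratio3 R) (triples A).
rewrite -(ler_nat R) natrX natrM.
have := card_triples A2; rewrite -/n -(ler_nat R) natrM natrX.
move: EH; set E := #|` collisions _ _|%:R; set T := #|` triples A|%:R.
set r := #|` _ @` triples A|%:R; set H := 1 + ln _.
move=> EH hT hC.
have n_gt0 : (0 : R) < n%:R ^+ 4 by rewrite exprn_gt0 // ltr0n; lia.
rewrite -(ler_pM2r n_gt0).
have h1 : n%:R ^+ 2 * n%:R ^+ 4 <= 4 * T ^+ 2.
  have -> : n%:R ^+ 2 * n%:R ^+ 4 = (n%:R ^+ 3) ^+ 2 :> R by ring.
  have -> : 4 * T ^+ 2 = (2 * T) ^+ 2 by ring.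
  rewrite lerXn2r ?nnegrE ?exprn_ge0 ?mulr_ge0 //.
have h2 : r * E <= r * (1029 * n%:R ^+ 4 * H) by rewrite ler_wpM2l.
apply: (le_trans h1); apply: (le_trans (ler_wpM2l _ (le_trans hC h2))) => //.
by rewrite le_eqVlt; apply/orP; left; apply/eqP; ring.
Qed.

(** * Growth from the symmetry 1 - X = X *)

(** Exchanging [a] and [c] reverses the affine frame. *)
Lemma one_sub_ratio3 (R : realType) (A : {fset R}) (x : R) :
  x \in @ratio3 R @` triples A -> 1 - x \in @ratio3 R @` triples A.
Proof.
case/imfsetP => -[[a b] c] /triplesP[aA bA cA ca] ->.
have ac : a - c != 0 by rewrite -opprB oppr_eq0.
apply/imfsetP; exists (c, b, a); first exact/triplesP.
by rewrite /ratio3 /=; field; rewrite ca ac.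
Qed.

(* The line [v = z - (z / y) u] carries the points [(x y, (1 - x) z)]. *)
Lemma card_prodset_one_sub (R : realType) (X Y : {fset R}) :
  {in X, forall x, 1 - x \in X} -> X != fset0 -> 0 \notin Y ->
  (#|` Y| ^ 2 * #|` X| ^ 3 <= 343 * #|` prodset X Y| ^ 4)%N.
Proof.
move=> X1 /fset0Pn[x0 x0X] Y0; set P := prodset X Y.
have Yneq0 y : y \in Y -> y != 0 by move=> yY; apply: contraNneq Y0 => <-.
(* Supplies the a priori bound |Y|^2 <= |P|^4 on the number of lines. *)
have YP : (#|` Y| <= #|` P|)%N.
  have [x xX x_neq0] : exists2 x, x \in X & x != 0.
    have [e|] := eqVneq x0 0; last by exists x0.
    by exists (1 - x0); [exact: X1|rewrite e subr0 oner_neq0].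
  apply: (@leq_card_fset_inj _ _ ( *%R x)); last by move=> y z _ _ /(mulfI x_neq0).
  by move=> y yY; apply/imfset2P; exists x => //; exists y.
pose L := [fset (- p.2 / p.1, p.2) | p in Y `*` Y].
have LE : #|` L| = (#|` Y| ^ 2)%N.
  rewrite card_in_imfset /= ?card_fsetM //.
  move=> [y z] [y' z']; rewrite !in_fsetM /= => /andP[/Yneq0 y0 /Yneq0 z0] _ [+ zz'].
  rewrite -zz' => /(mulfI _) e; congr (_, _) => //; apply: invr_inj; apply: e.
  by rewrite oppr_eq0.
have := @card_rich_lines_le _ P P L #|` X|; rewrite LE -expnD; apply.
  apply: (@leq_trans (#|` P| ^ 2)); first by rewrite leq_exp2r.
  by case: #|` P| => // p; rewrite leq_pexp2l.
move=> _ /imfsetP[[y z] /= + ->]; rewrite in_fsetM /= => /andP[yY zY].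
have y0 := Yneq0 _ yY; have z0 := Yneq0 _ zY.
split=> /=; first by rewrite mulf_neq0 ?invr_eq0 ?oppr_eq0.
apply: (@leq_card_fset_inj _ _ ( *%R^~ y)); last by move=> x x' _ _ /(mulIf y0).
move=> x xX; rewrite in_fset_sep; apply/andP; split.
  by apply/imfset2P; exists x => //; exists y.
apply/imfset2P; exists (1 - x); first exact: X1.
by exists z => //=; field.
Qed.

(** * A multiplicative Plunnecke-Ruzsa inequality *)

Lemma prodset0 (R : realType) (X : {fset R}) : prodset X fset0 = fset0.
Proof.
by apply/fsetP => x; rewrite in_fset0; apply/negP => /imfset2P[y _ [z]]; rewrite inE.
Qed.

Lemma mem_prodset (R : realType) (X Y : {fset R}) (x y : R) :
  x \in X -> y \in Y -> x * y \in prodset X Y.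
Proof. by move=> xX yY; apply/imfset2P; exists x => //; exists y. Qed.

Lemma prodsetP (R : realType) (X Y : {fset R}) (z : R) :
  z \in prodset X Y -> exists x y, [/\ x \in X, y \in Y & z = x * y].
Proof. by case/imfset2P => x xX [y yY ->]; exists x, y. Qed.

Lemma prodsetA (R : realType) (X Y Z : {fset R}) :
  prodset X (prodset Y Z) = prodset (prodset X Y) Z.
Proof.
apply/fsetP => w; apply/idP/idP.
  move=> /prodsetP[x [_ [xX /prodsetP[y [z [yY zZ ->]]] ->]]].
  by rewrite mulrA !mem_prodset.
move=> /prodsetP[_ [z [/prodsetP[x [y [xX yY ->]]] zZ ->]]].
by rewrite -mulrA !mem_prodset.
Qed.

(* Adding one element [c] to [C] creates at most [#|X B| - #|W B|] new products
   in [X B C] and exactly [#|X| - #|W|] new ones in [X C], where [W] consists of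
   the [x] for which [x c] already lies in [X C]. *)
Lemma petridis (R : realType) (X B C : {fset R}) :
  (forall Z, Z `<=` X ->
     #|` prodset X B| * #|` Z| <= #|` prodset Z B| * #|` X|)%N ->
  0 \notin C ->
  (#|` prodset (prodset X B) C| * #|` X| <= #|` prodset X B| * #|` prodset X C|)%N.
Proof.
move=> Xmin; move: {2}#|` C| (erefl #|` C|) => k; elim: k C => [|k IHk] C Ck C0.
  by rewrite (cardfs0_eq Ck) prodset0 cardfs0.
have [Ce|[c cC]] := fset_0Vmem C; first by rewrite Ce cardfs0 in Ck.
have c_neq0 : c != 0 by apply: contraNneq C0 => <-.
set C' := C `\ c.
have C'C : C' `<=` C by apply: fsubsetDl.
have CE z : z \in C -> z = c \/ z \in C'.
  by rewrite in_fsetD1 => ->; case: eqP => [->|_]; [left|right].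
have {}IHk : (#|` prodset (prodset X B) C'| * #|` X|
              <= #|` prodset X B| * #|` prodset X C'|)%N.
  apply: IHk; first by move: Ck; rewrite (cardfsD1 c) cC add1n => -[].
  by apply: contra C0 => /(fsubsetP C'C).
pose W := [fset x in X | x * c \in prodset X C'].
have WX : W `<=` X by apply/fsubsetP => x; rewrite in_fset_sep => /andP[].
have WBXB : prodset W B `<=` prodset X B.
  apply/fsubsetP => _ /prodsetP[x [b [/(fsubsetP WX) xX bB ->]]].
  exact: mem_prodset.
have new_le : (#|` prodset (prodset X B) C| + #|` prodset W B| <=
    #|` prodset (prodset X B) C'| + #|` prodset X B|)%N.
  rewrite -(cardfsID (prodset (prodset X B) C') (prodset (prodset X B) C)).
  rewrite -addnA leq_add //.
    by apply/fsubset_leq_card/fsubsetP => z; rewrite in_fsetI => /andP[].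
  rewrite -(subnK (fsubset_leq_card WBXB)) -cardfsDS // leq_add2r.
  apply: leq_trans (leq_card_fimfset ( *%R^~ c) (prodset X B `\` prodset W B)).
  apply/fsubset_leq_card/fsubsetP => z; rewrite in_fsetD => /andP[+ zP].
  have [_ [c1 [/prodsetP[x [b [xX bB ->]]] /CE cC1 ->]]] := prodsetP zP.
  case: cC1 => [->|c1C']; last by rewrite !mem_prodset.
  move=> zN; apply: in_imfset; rewrite /= in_fsetD (mem_prodset xX bB) andbT.
  (* If x b = w b' with w in [W], then x b c = (w c) b' lies in X C' B, so it is not new. *)
  apply: contra zN => /prodsetP[w [b' [+ b'B ->]]].
  rewrite in_fset_sep => /andP[_ /prodsetP[x' [c' [x'X c'C' e]]]].
  by rewrite mulrAC e mulrAC !mem_prodset.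
have new_ge : (#|` prodset X C'| + #|` X| <= #|` prodset X C| + #|` W|)%N.
  rewrite -(cardfsID (prodset X C') (prodset X C)) -addnA leq_add //.
    apply/fsubset_leq_card/fsubsetP => z zP; rewrite in_fsetI zP andbT.
    have [x [c' [xX /(fsubsetP C'C) c'C ->]]] := prodsetP zP.
    exact: mem_prodset.
  rewrite -(subnK (fsubset_leq_card WX)) -cardfsDS // leq_add2r.
  apply: (@leq_card_fset_inj _ _ ( *%R^~ c)); last by move=> x y _ _ /(mulIf c_neq0).
  move=> x; rewrite !in_fsetD in_fset_sep => /andP[+ xX].
  by rewrite xX /= => ->; rewrite mem_prodset.
(* Minimality at [W] reads |X B| |W| <= |W B| |X|, so |X| times the increase |X B| - |W B| is at
   most |X B| (|X| - |W|). *)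
have := Xmin W WX; have := fsubset_leq_card WBXB; have := fsubset_leq_card WX.
move: #|` prodset _ C| #|` prodset _ C| IHk new_le new_ge => p p'.
move: #|` X| #|` W| #|` prodset X B| #|` prodset W B| #|` prodset _ C'| #|` prodset _ C'|.
nia.
Qed.

(** [X] minimises |Z B| / |Z| over the nonempty subsets Z of [A]; the cross-multiplied form also
    covers empty Z. *)
Lemma exists_min_growth (R : realType) (A B : {fset R}) : A != fset0 ->
  exists X : {fset R}, [/\ X `<=` A, X != fset0 &
    forall Z, Z `<=` A ->
      (#|` prodset X B| * #|` Z| <= #|` prodset Z B| * #|` X|)%N].
Proof.
move=> A0; have AA : A \in fpowerset A by rewrite fpowersetE.
pose F (Z : fpowerset A) : rat := #|` prodset (val Z) B|%:R / #|` val Z|%:R.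
have [X X0 Xmin] := @arg_minP _ _ _ [` AA] (fun Z => val Z != fset0) F A0.
exists (val X); split=> //; first by rewrite -fpowersetE; exact: valP.
move=> Z ZA; have [->|Z0] := eqVneq Z fset0; first by rewrite cardfs0 muln0.
rewrite -fpowersetE in ZA; have := Xmin [` ZA] Z0.
rewrite /F /= ler_pdivrMr ?ltr0n ?cardfs_gt0 // mulrAC.
by rewrite ler_pdivlMr ?ltr0n ?cardfs_gt0 // -!natrM ler_nat.
Qed.

(** For each quotient u / v, the pairs (x u, x v) are |X| distinct pairs with that same quotient. *)
Lemma ruzsa_triangle (R : realType) (X U V : {fset R}) :
  0 \notin X -> 0 \notin V ->
  (#|` X| * #|` [fset u / v | u in U, v in V]| <=
   #|` prodset X U| * #|` prodset X V|)%N.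
Proof.
move=> X0 V0; rewrite -(card_fsetM (prodset X U)) mulnC.
set W := [fset _ | _ in _, _ in _].
apply: (@leq_trans (\sum_(w <- W)
   #|` [fset p in prodset X U `*` prodset X V | p.1 / p.2 == w]|)).
  rewrite (card_fset_sum1 W) big_distrl /= big_seq [leqRHS]big_seq.
  apply: leq_sum => _ /imfset2P[u uU [v vV ->]]; rewrite mul1n.
  have v_neq0 : v != 0 by apply: contraNneq V0 => <-.
  apply: (@leq_card_fset_inj _ _ (fun x => (x * u, x * v))).
    move=> x xX; rewrite in_fset_sep in_fsetM /= !mem_prodset //=.
    have x_neq0 : x != 0 by apply: contraNneq X0 => <-.
    by apply/eqP; field; rewrite v_neq0 x_neq0.
  by move=> x y _ _ [_ /(mulIf v_neq0)].
apply: (@leq_sum_card_inj _ _ _ _ _ _ (fun _ p => p)).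
  by move=> w p _; rewrite in_fset_sep => /andP[].
move=> w p w' p' _ + _ + pp'; rewrite -pp' !in_fset_sep.
by move=> /andP[_ /eqP<-] /andP[_ /eqP<-].
Qed.

(** For the minimiser X, [petridis] and the triangle inequality give |X|^2 |B B / B| <= |X B|^3.
    Then |X B| / |X| <= |A B| / |A| and |X| <= |A| replace X by [A]. *)
Lemma plunnecke_ruzsa (R : realType) (A B : {fset R}) :
  A != fset0 -> 0 \notin A -> 0 \notin B ->
  (#|` [fset u / v | u in prodset B B, v in B]| * #|` A| ^ 2 <=
   #|` prodset A B| ^ 3)%N.
Proof.
move=> A_neq0 A0 B0; have [X [XA X_neq0 Xmin]] := exists_min_growth B A_neq0.
have X0 : 0 \notin X by apply: contra A0 => /(fsubsetP XA).
have h1 := Xmin A (fsubset_refl A).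
have h2 : (#|` prodset X (prodset B B)| * #|` X| <= #|` prodset X B| ^ 2)%N.
  rewrite prodsetA -mulnn; apply: petridis => // Z ZX.
  exact: Xmin (fsubset_trans ZX XA).
have h3 := ruzsa_triangle (prodset B B) X0 B0.
have h4 := fsubset_leq_card XA.
move: X_neq0 A_neq0 h1 h2 h3 h4; rewrite -!cardfs_gt0.
move: #|` X| #|` A| #|` prodset X B| #|` prodset A B| #|` prodset X (prodset B B)|.
move: #|` [fset _ | _ in _, _ in _]| => t x a s p m x0 a0 h1 h2 h3 h4.
have h5 : (x ^ 2 * t <= s ^ 3)%N.
  rewrite -mulnn -mulnA (leq_trans (leq_mul (leqnn x) h3)) // mulnA (mulnC x).
  by rewrite [(s ^ 3)%N]expnSr leq_mul.
have h6 : (s ^ 3 * a ^ 3 <= p ^ 3 * x ^ 3)%N by rewrite -!expnMn leq_exp2r.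
have h7 : (x ^ 2 * t * a ^ 3 <= p ^ 3 * x ^ 3)%N.
  exact: leq_trans (leq_mul h5 (leqnn _)) h6.
have h8 : (t * a ^ 3 <= p ^ 3 * a)%N.
  apply: (@leq_trans (p ^ 3 * x)); last by rewrite leq_mul.
  rewrite -(leq_pmul2l (m := x ^ 2)) ?expn_gt0 ?x0 //.
  by rewrite mulnA (leq_trans h7) // mulnCA -expnSr.
by move: h8; rewrite [(a ^ 3)%N]expnSr mulnA leq_pmul2r.
Qed.

(** * Difference sets and their ratios *)

Lemma diffset_size (R : realType) (A : {fset R}) : (2 <= #|` A|)%N ->
  [/\ (#|` diffset A A| <= #|` A| ^ 2)%N, (#|` A| <= #|` diffset A A|)%N &
      0 \in diffset A A].
Proof.
move=> A2; have [A0|[a aA]] := fset_0Vmem A; first by rewrite A0 cardfs0 in A2.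
have DP x y : x \in A -> y \in A -> x - y \in diffset A A.
  by move=> xA yA; apply/imfset2P; exists x => //; exists y.
split; last by rewrite -(subrr a) DP.
- rewrite -mulnn -card_fsetM.
  apply: leq_trans (leq_card_fimfset (fun p => p.1 - p.2) (A `*` A)).
  apply/fsubset_leq_card/fsubsetP => _ /imfset2P[x xA [y yA ->]].
  by apply/imfsetP; exists (x, y); rewrite //= in_fsetM xA yA.
- apply: (@leq_card_fset_inj _ _ (fun x => x - a)) => [x xA|x y _ _ /addIr //].
  exact: DP.
Qed.

(** The involution [g] carries a nonzero product d (b - a) / (c - a) to an element of B B / B; the
    extra 1 accounts for the product 0. *)
Lemma card_prodset_ratio3 (R : realType) (A : {fset R}) (g : R -> R)
    (D0 := diffset A A `\ 0) (B := g @` D0) :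
  involutive g -> {morph g : x y / x * y} -> {morph g : x / x^-1} ->
  (#|` prodset (@ratio3 R @` triples A) D0| <=
     #|` [fset u / v | u in prodset B B, v in B]| + 1)%N.
Proof.
move=> gK gM gV; set P := prodset _ _; set T := [fset _ | _ in _, _ in _].
have gD x : x \in D0 -> g x \in B by move=> xD; apply/imfsetP; exists x.
have DP x y : x \in A -> y \in A -> x - y != 0 -> x - y \in D0.
  move=> xA yA xy; rewrite in_fsetD1 xy.
  by apply/imfset2P; exists x => //; exists y.
apply: (@leq_trans (#|` P `\ 0| + 1)).
  by rewrite (cardfsD1 0 P) addnC leq_add2l leq_b1.
rewrite leq_add2r; apply: (@leq_card_fset_inj _ _ g); last first.
  by move=> x y _ _ /(can_inj gK).
move=> x; rewrite in_fsetD1 => /andP[x0 xP].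
have [r [d [/imfsetP[[[a b] c] /triplesP[aA bA cA ca] re] dD xE]]] := prodsetP xP.
have ba : b - a != 0.
  by apply: contraNneq x0 => ba; rewrite xE re /ratio3 /= ba !mul0r.
apply/imfset2P; exists (g ((b - a) * d)).
  by rewrite gM; apply: mem_prodset; rewrite gD ?DP.
exists (g (c - a)); first by rewrite gD // DP.
by rewrite xE re /ratio3 /= -gV -gM; congr g; rewrite mulrAC.
Qed.

(** * Exponents, constants and conclusion *)

(** Here [d <= P] absorbs the extra 1, giving p d^2 <= 2 P^3; its fourth power eliminates [p]. *)
Lemma growth_nat (d r p t P : nat) : (0 < d)%N -> (d <= P)%N ->
  (d ^ 2 * r ^ 3 <= 343 * p ^ 4)%N -> (p <= t + 1)%N -> (t * d ^ 2 <= P ^ 3)%N ->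
  (d ^ 10 * r ^ 3 <= 343 * 16 * P ^ 12)%N.
Proof.
move=> d0 dP h1 h2 h3.
have h4 : (p * d ^ 2 <= 2 * P ^ 3)%N.
  have : (d ^ 2 <= P ^ 3)%N.
    apply: (@leq_trans (P ^ 2)); first by rewrite leq_exp2r.
    by rewrite leq_pexp2l // (leq_trans d0).
  by have := leq_mul h2 (leqnn (d ^ 2)); rewrite mulnDl mul1n; lia.
have h5 : (p ^ 4 * d ^ 8 <= 16 * P ^ 12)%N.
  by rewrite -[8%N]/(2 * 4)%N -[12%N]/(3 * 4)%N !expnM -[16%N]/(2 ^ 4)%N -!expnMn leq_exp2r.
apply: (@leq_trans (343 * p ^ 4 * d ^ 8)).
  by rewrite -[10%N]/(2 + 8)%N expnD mulnAC leq_mul2r h1 orbT.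
by rewrite -(mulnA 343%N (p ^ 4)%N) -(mulnA 343%N 16%N); exact: leq_mul.
Qed.

(** Both 1 and ln d are at most log2 d, because [d >= 2] and ln 2 <= 1. *)
Lemma log2_bound (R : realType) (n d : nat) : (0 < n <= d)%N -> (2 <= d)%N ->
  1 + ln (n%:R : R) <= 2 * log2 (d%:R : R) /\ 0 < log2 (d%:R : R).
Proof.
move=> /andP[n0 nd] d2.
have ln2_gt0 : 0 < ln (2 : R) by apply: ln_gt0; rewrite ltr1n.
have ln2_le1 : ln (2 : R) <= 1.
  by apply: (@le_ln1Dx R 1); lra.
have lnd : ln (2 : R) <= ln d%:R by rewrite ler_ln ?posrE ?ltr0n ?ler_nat //; lia.
have lnn : ln (n%:R : R) <= ln d%:R by rewrite ler_ln ?posrE ?ltr0n ?ler_nat //; lia.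
have h1 : 1 <= log2 (d%:R : R) by rewrite /log2 ler_pdivlMr ?mul1r.
have h2 : ln (d%:R : R) <= log2 d%:R.
  by rewrite /log2 ler_pdivlMr // ler_piMr // (le_trans _ lnd) // ltW.
by split; lra.
Qed.

(** Twelfth powers turn the exponents 13/12 and -1/4 into 13 and -3; the factor [K^-1] is affordable
    because [K <= K ^ 12]. *)
Lemma growth_root (R : realType) (K d l P : R) : 1 <= K -> 0 < d -> 0 < l -> 0 < P ->
  d ^+ 13 <= K * P ^+ 12 * l ^+ 3 ->
  K^-1 * d `^ (1 + 1 / 12) * l `^ (- (1 / 4)) <= P.
Proof.
move=> K1 d0 l0 P0 h; have K0 : 0 < K by lra.
have n12 : (0 < 12)%N by [].
have d0' := ltW d0; have l0' := ltW l0; have P0' := ltW P0; have K0' := ltW K0.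
have powX (x y : R) : (x `^ y) ^+ 12 = x `^ (y * 12) by rewrite powRrM powR_mulrn ?powR_ge0.
rewrite -(ler_pXn2r n12) ?nnegrE ?mulr_ge0 ?powR_ge0 ?invr_ge0 //.
rewrite !exprMn !powX.
have -> : (1 + 1 / 12) * 12 = 13%:R :> R by field.
have -> : - (1 / 4) * 12 = - 3%:R :> R by field.
rewrite powRN !powR_mulrn //.
rewrite ler_pdivrMr ?exprn_gt0 // exprVn mulrC ler_pdivrMr ?exprn_gt0 //.
apply: (le_trans h); rewrite -mulrA mulrC ler_wpM2l ?mulr_ge0 ?exprn_ge0 //.
by rewrite ler_eXnr.
Qed.

(** Split 13 = 10 + 3: ten factors [d] are bounded through [e] and three through [r], matching e^10
    r^3. *)
Lemma growth_real (R : realType) (k1 k2 d e r l m p : R) :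
  0 <= k1 -> 0 <= d -> 0 <= e -> 0 <= r -> 0 <= l ->
  d <= k1 * r * m -> m <= 2 * l -> d <= 2 * e ->
  e ^+ 10 * r ^+ 3 <= k2 * p ^+ 12 ->
  d ^+ 13 <= (2 ^+ 10 * k2 * (2 * k1) ^+ 3) * p ^+ 12 * l ^+ 3.
Proof.
move=> k1_ge0 d_ge0 e_ge0 r_ge0 l_ge0 hd hm hde main.
have {hm}hd : d <= 2 * k1 * (r * l).
  have -> : 2 * k1 * (r * l) = k1 * r * (2 * l) by ring.
  by rewrite (le_trans hd) // ler_wpM2l // mulr_ge0.
have -> : d ^+ 13 = d ^+ 10 * d ^+ 3 by rewrite -exprD.
have h10 : d ^+ 10 <= 2 ^+ 10 * e ^+ 10.
  by rewrite -exprMn lerXn2r ?nnegrE ?mulr_ge0.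
have h3 : d ^+ 3 <= (2 * k1) ^+ 3 * (r ^+ 3 * l ^+ 3).
  by rewrite -!exprMn lerXn2r ?nnegrE // !mulr_ge0.
apply: (le_trans (ler_pM _ _ h10 h3)); rewrite ?exprn_ge0 //.
have k0 : 0 <= 2 ^+ 10 * (2 * k1) ^+ 3 * l ^+ 3.
  by rewrite !(mulr_ge0, exprn_ge0).
have := ler_wpM2l k0 main; move: (2 ^+ 10) => k.
by congr (_ <= _); ring.
Qed.

(** Stated for a multiplicative involution so that the identity serves products and inversion serves
    quotients. *)
Lemma card_growth (R : realType) (A : {fset R}) (g : R -> R) (P : nat)
    (D := diffset A A) (D0 := D `\ 0) :
  (2 <= #|` A|)%N ->
  involutive g -> {morph g : x y / x * y} -> {morph g : x / x^-1} ->
  (#|` prodset D0 (g @` D0)| <= P)%N ->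
  #|` D|%:R ^+ 13 <=
    (2 ^+ 10 * (343 * 16) * (2 * 4116) ^+ 3) * P%:R ^+ 12 * log2 #|` D|%:R ^+ 3 :> R.
Proof.
move=> A2 gK gM gV leP; have [leDA leAD D_0] := diffset_size A2.
have g0 : g 0 = 0.
  by have := gM 0 (g 0); rewrite mul0r gK mulr0.
set B := g @` D0; set X := @ratio3 R @` triples A.
have B0 : 0 \notin B.
  apply/imfsetP => -[x /= + /(congr1 g)]; rewrite g0 gK => /[swap] <-.
  by rewrite in_fsetD1 eqxx.
have D00 : 0 \notin D0 by rewrite in_fsetD1 eqxx.
have DE : #|` D| = (#|` D0| + 1)%N by rewrite (cardfsD1 0 D) D_0 addnC.
have d_gt0 : (0 < #|` D0|)%N by move: DE leAD; rewrite -/D; lia.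
have D0_neq0 : D0 != fset0 by rewrite -cardfs_gt0.
have BE : #|` B| = #|` D0| by rewrite card_imfset //; exact: can_inj gK.
have DP : (#|` D0| <= P)%N.
  have [b bB] : exists b, b \in B by apply/fset0Pn; rewrite -cardfs_gt0 BE.
  have b0 : b != 0 by apply: contraNneq B0 => <-.
  apply: leq_trans leP; apply: (@leq_card_fset_inj _ _ ( *%R^~ b)).
    by move=> x xD; exact: mem_prodset.
  by move=> x y _ _ /(mulIf b0).
have X_neq0 : X != fset0.
  rewrite -cardfs_gt0; have := card_triples A2.
  have : (0 < #|` A| ^ 3)%N by rewrite expn_gt0; lia.
  case: (fset_0Vmem (triples A)) => [->|[t tT] _ _]; first by rewrite cardfs0; lia.
  by rewrite cardfs_gt0; apply/fset0Pn; exists (ratio3 t); exact: in_imfset.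
have hX := card_prodset_one_sub (@one_sub_ratio3 R A) X_neq0 D00.
have hT := card_prodset_ratio3 A gK gM gV.
have hP : (#|` [fset u / v | u in prodset B B, v in B]| * #|` D0| ^ 2 <= P ^ 3)%N.
  by apply: leq_trans (plunnecke_ruzsa D0_neq0 D00 B0) _; rewrite leq_exp2r.
have main := growth_nat d_gt0 DP hX hT hP.
have [hl l_gt0] : 1 + ln (#|` A|%:R : R) <= 2 * log2 #|` D|%:R
    /\ 0 < log2 (#|` D|%:R : R).
  by apply: log2_bound; rewrite ?leAD ?(leq_trans A2) // (leq_trans _ A2).
have {}leDA : (#|` D|%:R : R) <= #|` A|%:R ^+ 2 by rewrite -natrX ler_nat.
have {}DE : (#|` D|%:R : R) <= 2 * #|` D0|%:R.
  by rewrite DE -natrM ler_nat mul2n -addnn leq_add2l.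
have {}main : (#|` D0|%:R : R) ^+ 10 * #|` X|%:R ^+ 3 <= 343 * 16 * P%:R ^+ 12.
  by rewrite -!natrX -!natrM ler_nat.
have hd := le_trans leDA (card_ratio3 A2).
by apply: (growth_real _ _ _ _ _ hd hl DE main) => //; exact: ltW.
Qed.

Theorem theorem3 (R : realType) :
  exists2 c : R, 0 < c &
    forall A : {fset R}, (2 <= #|` A|)%N ->
      let D := diffset A A in
      c * #|` D|%:R `^ (1 + 1 / 12) * log2 #|` D|%:R `^ (- (1 / 4))
        <= #|` prodset D D|%:R
      /\
      c * #|` D|%:R `^ (1 + 1 / 12) * log2 #|` D|%:R `^ (- (1 / 4))
        <= #|` ratioset D D|%:R.
Proof.
(* The constant produced by [card_growth]. *)
pose K : R := 2 ^+ 10 * (343 * 16) * (2 * 4116) ^+ 3.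
have K1 : 1 <= K.
  have le1 (m : nat) : (0 < m)%N -> 1 <= m%:R :> R by rewrite ler1n.
  by rewrite /K !(mulr_ege1, exprn_ege1) ?le1.
exists K^-1; first by rewrite invr_gt0 (lt_le_trans ltr01).
move=> A A2 D; have [_ leAD D_0] := diffset_size A2.
have [_ l_gt0] : 1 + ln (#|` A|%:R : R) <= 2 * log2 #|` D|%:R
    /\ 0 < log2 (#|` D|%:R : R).
  by apply: log2_bound; rewrite ?leAD ?(leq_trans A2) // (leq_trans _ A2).
have d_gt0 : 0 < #|` D|%:R :> R by rewrite ltr0n cardfs_gt0; apply/fset0Pn; exists 0.
suff bound (g : R -> R) (V : {fset R}) : 0 \in V ->
    involutive g -> {morph g : x y / x * y} -> {morph g : x / x^-1} ->
    prodset (D `\ 0) (g @` (D `\ 0)) `<=` V ->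
    K^-1 * #|` D|%:R `^ (1 + 1 / 12) * log2 #|` D|%:R `^ (- (1 / 4)) <= #|` V|%:R.
  split.
    apply: (bound id) => //; first by rewrite -(mulr0 0) mem_prodset.
    apply/fsubsetP => _ /prodsetP[x [_ [xD /imfsetP[y /= yD ->] ->]]].
    by apply: mem_prodset; [move: xD|move: yD]; rewrite in_fsetD1 => /andP[].
  (* A nonzero denominator is needed to write 0 as an element of D / D. *)
  have [d dD d0] : exists2 d, d \in D & d != 0.
    have : (0 < #|` D `\ 0%R|)%N.
      by have := leq_trans A2 leAD; rewrite (cardfsD1 0 (diffset A A)) D_0.
    rewrite cardfs_gt0 => /fset0Pn[d]; rewrite in_fsetD1 => /andP[d0 dD].
    by exists d.
  apply: (bound GRing.inv).
  - by apply/imfset2P; exists 0 => //; exists d; rewrite ?mul0r // inE dD.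
  - exact: invrK.
  - exact: invfM.
  - by [].
  apply/fsubsetP => _ /prodsetP[x [_ [xD /imfsetP[y /= yD ->] ->]]].
  apply/imfset2P; exists x; first by move: xD; rewrite in_fsetD1 => /andP[].
  by exists y => //; move: yD; rewrite in_fsetD1 inE andbC.
move=> V0 gK gM gV /fsubset_leq_card leV.
have V_gt0 : 0 < #|` V|%:R :> R by rewrite ltr0n cardfs_gt0; apply/fset0Pn; exists 0.
exact: growth_root K1 d_gt0 l_gt0 V_gt0 (card_growth A2 gK gM gV leV).
Qed.
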